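(* Let $X$ be an infinite dimensional, separable $F$-space and $T\in\mathcal{L}(X)$. Let $\mathcal{F}$ be a filter on $\mathbb{N}$. Then $T$ satisfies $\mathcal{F}$-Kitai's Criterion if and only if $(X,T)$ is $\mathcal{F}$-transitive and for every $x\in X$ the set $P_{\mathcal{F}}(x)$ is dense in $X$.
   Context: $\mathbb{N}=\{1,2,3,\dots\}$. $\mathcal{L}(X)$ is the set of all bounded (i.e. continuous) linear operators on $X$, and $\|\cdot\|$ denotes the $F$-norm of $X$ (so $(x,y)\mapsto\|x-y\|$ is a complete translation-invariant metric inducing the topology). A (Furstenberg) family on $\mathbb{N}$ is a non-empty collection of infinite subsets of $\mathbb{N}$ that is hereditarily upward (if $A\in\mathcal{F}$ and $A\subset B\subset\mathbb{N}$ then $B\in\mathcal{F}$). A filter on $\mathbb{N}$ is a family $\mathcal{F}$ such that $A\cap B\in\mathcal{F}$ for all $A,B\in\mathcal{F}$. $(X,T)$ is $\mathcal{F}$-transitive if for every pair of non-empty open sets $U,V\subset X$, $\{n\in\mathbb{N}:T^n(U)\cap V\neq\emptyset\}\in\mathcal{F}$. $\mathcal{F}$-$\lim_n x_n=x$ means that for every open set $U$ containing $x$, $\{n\in\mathbb{N}:x_n\in U\}\in\mathcal{F}$. $T$ satisfies $\mathcal{F}$-Kitai's Criterion if there exist two dense subsets $D_1,D_2$ of $X$ and a sequence of mappings $S_n:D_2\to X$ ($n\in\mathbb{N}$; not assumed linear or continuous) such that (i) $\mathcal{F}$-$\lim_n T^n(x)=0$ for every $x\in D_1$; (ii) $\mathcal{F}$-$\lim_n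 (S_n(y),T^n(S_n(y)))=(0,y)$ in $X\times X$ for every $y\in D_2$. A pair $(x,y)\in X\times X$ is $\mathcal{F}$-proximal if for every $\varepsilon>0$ the set $\{n\in\mathbb{N}:\|T^n(x)-T^n(y)\|<\varepsilon\}$ belongs to $\mathcal{F}$. The $\mathcal{F}$-proximal cell of $x$ is $P_{\mathcal{F}}(x)=\{y\in X:(x,y)\text{ is }\mathcal{F}\text{-proximal}\}$. *)

(* Defs.v *)
From HB Require Import structures.
From mathcomp Require Import all_boot all_order all_algebra.
From mathcomp Require Import all_classical all_reals topology normedtype.
From mathcomp Require Import complex.
Import Order.TTheory GRing.Theory Num.Theory.
Import numFieldNormedType.Exports.

Set Implicit Arguments.
Unset Strict Implicit.
Unset Printing Implicit Defensive.

Local Open Scope classical_set_scope.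
Local Open Scope ring_scope.
Local Open Scope complex_scope.

Variant scalar_kind := RealScalars | ComplexScalars.

Definition scalar_field (R : realType) (k : scalar_kind) : numFieldType :=
  match k with
  | RealScalars => R
  | ComplexScalars => R[i]
  end.

(* A topological vector space over K (not necessarily locally convex, unlike the
   library's tvsType) together with an F-norm: a function such that
   (x, y) |-> fnorm (x - y) is a complete metric inducing the topology.
   The library's norms are not used because they satisfy
   `|x *+ n| = `|x| *+ n, which fails for F-norms. *)
HB.mixin Record TopologicalLmodule_isFSpace (R : realType) (K : numFieldType) X
    & TopologicalLmodule K X := {
  fnorm : X -> R ;
  fnorm_ge0 : forall x, 0 <= fnorm x ;
  fnorm_eq0 : forall x, fnorm x = 0 <-> x = 0 ;
  fnormN : forall x, fnorm (- x) = fnorm x ;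
  fnormD : forall x y, fnorm (x + y) <= fnorm x + fnorm y ;
  nbhs_fnorm : forall (x : X) (A : set X),
    nbhs x A <-> exists2 e : R, 0 < e & [set y | fnorm (x - y) < e] `<=` A ;
  fnorm_complete : forall u : nat -> X,
    (forall e : R, 0 < e -> exists N : nat, forall m n : nat,
      (N <= m)%N -> (N <= n)%N -> fnorm (u m - u n) < e) ->
    exists l : X, u @ \oo --> l
}.

#[short(type="fspaceType")]
HB.structure Definition FSpace (R : realType) (K : numFieldType) :=
  {X of TopologicalLmodule K X & TopologicalLmodule_isFSpace R K X}.

Definition finite_dimensional (K : numFieldType) (V : lmodType K) : Prop :=
  exists (n : nat) (e : 'I_n -> V),
    forall v : V, exists c : 'I_n -> K, v = \sum_(i < n) c i *: e i.

Definition infinite_dimensional (K : numFieldType) (V : lmodType K) : Prop :=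
  ~ finite_dimensional V.

Definition separable (X : topologicalType) : Prop :=
  exists2 D : set X, countable D & dense D.

(* The index set {1, 2, 3, ...}. *)
Definition posnat : Type := {n : nat | (0 < n)%N}.

Definition furstenberg_family (F : set (set posnat)) : Prop :=
  [/\ F !=set0,
      forall A, F A -> infinite_set A
    & forall A B, F A -> A `<=` B -> F B].

(* Unlike the library's Filter, members are required to be infinite sets. *)
Definition furstenberg_filter (F : set (set posnat)) : Prop :=
  furstenberg_family F /\ forall A B, F A -> F B -> F (A `&` B).

Definition F_lim (F : set (set posnat)) (Y : topologicalType)
    (u : posnat -> Y) (l : Y) : Prop :=
  forall U : set Y, open U -> U l -> F [set n | U (u n)].

Section dynamics.
Variables (R : realType) (K : numFieldType) (X : fspaceType R K).
Variables (F : set (set posnat)) (T : X -> X).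

Definition F_transitive : Prop :=
  forall U V : set X, open U -> U !=set0 -> open V -> V !=set0 ->
    F [set n | (iter (val n) T @` U) `&` V !=set0].

(* Each S n is a total function, but only its values on D2 are constrained. *)
Definition F_Kitai_criterion : Prop :=
  exists (D1 D2 : set X) (S : posnat -> X -> X),
    [/\ dense D1,
        dense D2,
        forall x, D1 x -> F_lim F (fun n => iter (val n) T x) 0
      & forall y, D2 y ->
          F_lim F (fun n => (S n y, iter (val n) T (S n y))) (0, y)].

Definition F_proximal (x y : X) : Prop :=
  forall e : R, 0 < e ->
    F [set n | fnorm (iter (val n) T x - iter (val n) T y) < e].

Definition F_proximal_cell (x : X) : set X := [set y | F_proximal x y].

End dynamics.

(* Main.v *)
(* For the converse, put S_n y := a point z making both |z| and |T^n z - y|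
   nearly as small as possible at time n, up to precision 1/(n+1).  Such points
   work along F as soon as F contains every set {n | k <= n}.  This is not part
   of the definition of a filter, but follows from the dynamics: if all members
   of F contain some m, then proximality to 0 forces T^m = 0 on a dense set, so
   T^m = 0, which contradicts transitivity. *)
Require Import Defs.
From mathcomp Require Import all_boot all_order all_algebra.
From mathcomp Require Import all_classical all_reals topology normedtype.
From mathcomp Require Import lra.
Import Order.TTheory GRing.Theory Num.Theory.

Local Open Scope classical_set_scope.
Local Open Scope ring_scope.

(** * Filters of infinite sets of positive integers *)

Section FurstenbergFilter.
Context {F : set (set posnat)} (FF : furstenberg_filter F).

Lemma furstenberg_sub (A B : set posnat) : A `<=` B -> F A -> F B.
Proof. by move: FF => [[_ _ up] _] AB FA; exact: up FA AB. Qed.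

Lemma furstenbergI (A B : set posnat) : F A -> F B -> F (A `&` B).
Proof. by move: FF => [_]; apply. Qed.

Lemma furstenbergT : F setT.
Proof. by move: FF => [[[A FA] _ _] _]; apply: furstenberg_sub FA. Qed.

(** A tail is a finite intersection of complements of single points; the induction removes one point
    at a time. *)
Lemma furstenberg_ge :
  (forall m : posnat, F [set n | n <> m]) ->
  forall k : nat, F [set n : posnat | (k <= val n)%N].
Proof.
move=> Fneq; elim=> [|k IH]; first by apply: furstenberg_sub furstenbergT.
have [k0|k_gt0] := posnP k.
  by apply: furstenberg_sub furstenbergT => -[n n_gt0] _; rewrite /= k0.
apply: furstenberg_sub (furstenbergI _ _ IH (Fneq (exist _ k k_gt0))).
move=> n [/= kn nk]; rewrite ltn_neqAle kn andbT.
by apply/eqP => E; apply: nk; apply: val_inj; exact: esym E.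
Qed.

End FurstenbergFilter.

(** * Balls, density and limits along [F] in an F-space *)

Section FSpaceTheory.
Context {R : realType} {K : numFieldType} {X : fspaceType R K}.
Implicit Types (x y z : X) (e : R).

Local Notation fnorm := (@fnorm R K X).

Lemma fnorm0 : fnorm 0 = 0.
Proof. exact/fnorm_eq0. Qed.

Lemma open_fball x e : open [set y | fnorm (x - y) < e].
Proof.
rewrite openE => y /= xy; apply/nbhs_fnorm.
exists (e - fnorm (x - y)); first by rewrite subr_gt0.
move=> z /= yz; have := fnormD (x - y) (y - z).
by rewrite addrA subrK; lra.
Qed.

Lemma open_fnormP (U : set X) x : open U -> U x ->
  exists2 e : R, 0 < e & [set y | fnorm (x - y) < e] `<=` U.
Proof. by rewrite openE => oU Ux; exact/nbhs_fnorm/oU. Qed.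

Lemma open_neq0 : open [set x : X | x <> 0].
Proof.
rewrite openE => x /= x0; apply/nbhs_fnorm; exists (fnorm x).
  by rewrite lt_def fnorm_ge0 andbT; apply/eqP => /fnorm_eq0.
by move=> y /= xy y0; move: xy; rewrite y0 subr0 ltxx.
Qed.

Lemma dense_fball (D : set X) x e : dense D -> 0 < e ->
  exists2 y, D y & fnorm (x - y) < e.
Proof.
move=> dD e0; have [||y [/= xy Dy]] := dD [set y | fnorm (x - y) < e].
- by exists x; rewrite /= subrr fnorm0.
- exact: open_fball.
by exists y.
Qed.

Lemma infinite_dimensional_neq0 : infinite_dimensional X -> exists x : X, x <> 0.
Proof.
move=> infX; apply: contrapT => X0; apply: infX.
exists 0%N, (fun=> 0) => v; exists (fun=> 0); rewrite big_ord0.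
by apply: contrapT => v0; apply: X0; exists v.
Qed.

Context (T : {linear X -> X}).

Lemma iterD n : {morph iter n T : x y / x + y}.
Proof. by elim: n => [//|n IH] x y; rewrite !iterS IH linearD. Qed.

Lemma iter0 n : iter n T 0 = 0.
Proof. by elim: n => [//|n IH]; rewrite iterS IH linear0. Qed.

Lemma iter_continuous n : continuous T -> continuous (iter n T).
Proof.
move=> cT; elim: n => [|n IH] x; first exact: cvg_id.
exact: (@continuous_comp _ _ _ (iter n T) T _ (IH x) (cT _)).
Qed.

Context (F : set (set posnat)) (FF : furstenberg_filter F).

Lemma F_lim_fnormP (u : posnat -> X) x :
  F_lim F u x <-> forall e, 0 < e -> F [set n | fnorm (x - u n) < e].
Proof.
split=> [ux e e0|ux U oU Ux].
  by apply: (ux [set y | fnorm (x - y) < e]); rewrite /= ?subrr ?fnorm0 //;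
    exact: open_fball.
have [e e0 xU] := open_fnormP _ _ oU Ux.
by apply: (furstenberg_sub FF) (ux _ e0) => n; exact: xU.
Qed.

(** A neighbourhood in the product contains a box, and [F] is closed under intersection. *)
Lemma F_lim_pair (u v : posnat -> X) x y :
  F_lim F (fun n => (u n, v n)) (x, y) <-> F_lim F u x /\ F_lim F v y.
Proof.
split=> [uv|[ux vy] U oU Uxy].
  split=> U oU Ul.
    apply: (uv (fst @^-1` U)) => //.
    by apply: open_comp => // z _; exact: cvg_fst.
  apply: (uv (snd @^-1` U)) => //.
  by apply: open_comp => // z _; exact: cvg_snd.
move: oU; rewrite openE => /(_ _ Uxy) [[A B] [/= Ax By] ABU].
have Fu := ux _ (open_interior A) Ax; have Fv := vy _ (open_interior B) By.
apply: (furstenberg_sub FF) (furstenbergI FF _ _ Fu Fv) => n [/= An Bn].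
by apply: ABU; split => /=; exact: interior_subset.
Qed.

Lemma F_proximal0P x : F_proximal F T 0 x <-> F_lim F (fun n => iter (val n) T x) 0.
Proof.
rewrite F_lim_fnormP; split=> h e e0; have := h e e0;
  by apply: (furstenberg_sub FF) => n /=; rewrite iter0.
Qed.

(** By linearity T^n x - T^n (x + y) = - T^n y, so the cell of x contains the translate by x of the
    cell of 0. *)
Lemma F_proximalDl x y : F_proximal F T 0 y -> F_proximal F T x (x + y).
Proof.
move=> py e e0; apply: (furstenberg_sub FF) (py e e0) => n /=.
by rewrite iter0 iterD sub0r opprD addrA subrr sub0r.
Qed.

Lemma F_proximal_cell_dense x :
  dense (F_proximal_cell F T 0) -> dense (F_proximal_cell F T x).
Proof.
move=> d0 U [u Uu] oU; have [e e0 uU] := open_fnormP _ _ oU Uu.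
have [y py uy] := dense_fball _ (u - x) _ d0 e0.
exists (x + y); split; last exact: F_proximalDl.
by apply: uU; rewrite /= opprD addrA.
Qed.

(** * Consequences of the criterion *)

Lemma F_Kitai_transitive : F_Kitai_criterion F T -> F_transitive F T.
Proof.
move=> [D1 [D2 [S [dD1 dD2 TD1 TD2]]]] U V oU U0 oV V0.
have [x [Ux D1x]] := dD1 _ U0 oU; have [y [Vy D2y]] := dD2 _ V0 oV.
have [e e0 xU] := open_fnormP _ _ oU Ux; have [d d0 yV] := open_fnormP _ _ oV Vy.
have [/F_lim_fnormP/(_ _ e0) FS /F_lim_fnormP TS] := (F_lim_pair _ _ _ _).1 (TD2 y D2y).
(* The distance from T^n (x + S_n y) to y is at most |T^n x| + |y - T^n (S_n y)|; each term gets
   half of [d]. *)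
have d20 : 0 < d / 2 by lra.
have /F_lim_fnormP/(_ _ d20) Fx := TD1 x D1x.
have {TS} FTS := TS _ d20.
apply: (furstenberg_sub FF) (furstenbergI FF _ _ (furstenbergI FF _ _ FS Fx) FTS).
move=> n [[/= Sn Txn] TSn].
exists (iter (val n) T (x + S n y)); split.
  exists (x + S n y) => //; apply: xU.
  by rewrite /= opprD addrA subrr.
apply: yV; rewrite /= iterD.
have := fnormD (0 - iter (val n) T x) (y - iter (val n) T (S n y)).
by rewrite addrACA add0r -opprD; lra.
Qed.

Lemma F_Kitai_proximal_dense x :
  F_Kitai_criterion F T -> dense (F_proximal_cell F T x).
Proof.
move=> [D1 [D2 [S [dD1 _ TD1 _]]]]; apply: F_proximal_cell_dense => U U0 oU.
have [y [Uy D1y]] := dD1 _ U0 oU.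
by exists y; split=> //; apply/F_proximal0P/TD1.
Qed.

(** * From transitivity and density to the criterion *)

Lemma transitive_proximal_neq (m : posnat) :
  continuous T -> (exists x : X, x <> 0) -> F_transitive F T ->
  dense (F_proximal_cell F T 0) -> F [set n | n <> m].
Proof.
move=> cT X0 tT dP; apply: contrapT => Fm.
(* A member of [F] missing [m] would force the larger set of all n <> m into [F]. *)
have memF A : F A -> A m.
  move=> FA; apply: contrapT => Am; apply: Fm.
  by apply: (furstenberg_sub FF) FA => n An nm; apply: Am; rewrite -nm.
pose V := [set x : X | x <> 0]; pose U := iter (val m) T @^-1` V.
have Tm0 x : iter (val m) T x = 0.
  apply: contrapT => Ux.
  have oU : open U.
    by apply: open_comp open_neq0 => z _; exact: iter_continuous.
  have [||y [Uy Py]] := dP U => //; first by exists x.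
  apply: Uy; apply/fnorm_eq0/eqP; rewrite eq_le fnorm_ge0 andbT leNgt.
  (* Proximality with radius |T^m y|, read at time [m], gives |T^m y| < |T^m y|. *)
  apply/negP => y0; have := memF _ (Py _ y0).
  by rewrite /= iter0 sub0r fnormN ltxx.
have /memF [_ [[x _ <-]]] := tT setT V openT (ex_intro _ 0 I) open_neq0 X0.
exact.
Qed.

Definition near_preimage (n : nat) y (k : nat) : set X :=
  [set z | fnorm z < k.+1%:R^-1 /\ fnorm (y - iter n T z) < k.+1%:R^-1].

Lemma near_preimage_le n y k l z :
  (k <= l)%N -> near_preimage n y l z -> near_preimage n y k z.
Proof.
move=> kl [zl Tzl].
have lk : (l.+1%:R^-1 : R) <= k.+1%:R^-1 by rewrite lef_pV2 ?posrE ?ltr0n ?ler_nat.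
by split; [exact: lt_le_trans zl lk|exact: lt_le_trans Tzl lk].
Qed.

(** The sets shrink as [k] grows, so a point of the last nonempty one lies in all earlier ones. The
    cap [N] ensures that a last one exists. *)
Lemma best_near_preimage n y N : exists z, forall k, (k <= N)%N ->
  near_preimage n y k !=set0 -> near_preimage n y k z.
Proof.
elim: N => [|N [z zP]].
  have [[z zP]|none] := pselect (near_preimage n y 0 !=set0).
    by exists z => k; rewrite leqn0 => /eqP ->.
  by exists 0 => k; rewrite leqn0 => /eqP ->.
have [[w wP]|none] := pselect (near_preimage n y N.+1 !=set0).
  by exists w => k kN _; exact: near_preimage_le wP.
by exists z => k; rewrite leq_eqVlt => /orP[/eqP -> //|kN]; exact: zP.
Qed.

Lemma transitive_near_preimage y k : F_transitive F T ->
  F [set n | near_preimage (val n) y k !=set0].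
Proof.
move=> tT.
have fball0 (x : X) : [set z | fnorm (x - z) < k.+1%:R^-1] !=set0.
  by exists x; rewrite /= subrr fnorm0 invr_gt0.
apply: (furstenberg_sub FF) (tT _ _ (open_fball 0 _) (fball0 0) (open_fball y _) (fball0 y)).
move=> n [_ [[z z0 <-] Tz]]; exists z.
by split=> //; move: z0; rewrite /= sub0r fnormN.
Qed.

Lemma transitive_proximal_Kitai :
  continuous T -> (exists x : X, x <> 0) -> F_transitive F T ->
  dense (F_proximal_cell F T 0) -> F_Kitai_criterion F T.
Proof.
move=> cT X0 tT dP.
(* The cap at time n is n itself, so precision [k] is reached at every time n >= k at which it is
   possible. *)
have [S SP] := choice (fun p : posnat * X =>
  best_near_preimage (val p.1) p.2 (val p.1)).
have FS y k : F [set n | near_preimage (val n) y k (S (n, y))].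
  have Fge := furstenberg_ge FF (fun m => transitive_proximal_neq m cT X0 tT dP) k.
  apply: (furstenberg_sub FF) (furstenbergI FF _ _ Fge (transitive_near_preimage y k tT)).
  by move=> n [kn]; exact: (SP (n, y)).
have small e : 0 < e -> exists k : nat, k.+1%:R^-1 < e.
  move=> e0; exists (Num.truncn e^-1).
  by rewrite invf_plt ?posrE ?ltr0n // truncnS_gt.
(* Vectors proximal to 0 are those whose orbit tends to 0 along [F], so they serve as D1; D2 is the
   whole space. *)
exists (F_proximal_cell F T 0), setT, (fun n y => S (n, y)); split=> //.
- by move=> U U0 _; rewrite setIT.
- by move=> x /F_proximal0P.
move=> y _; apply/F_lim_pair; split; apply/F_lim_fnormP => e /small[k ke];
    apply: (furstenberg_sub FF) (FS y k) => n [/= zk Tzk].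
  by rewrite sub0r fnormN; exact: lt_trans ke.
exact: lt_trans ke.
Qed.

End FSpaceTheory.

Theorem theorem3p12 (R : realType) (k : scalar_kind)
    (X : fspaceType R (scalar_field R k))
    (X_infdim : infinite_dimensional X) (X_separable : separable X)
    (T : {linear X -> X}) (T_continuous : continuous T)
    (F : set (set posnat)) (F_filter : furstenberg_filter F) :
  F_Kitai_criterion F T <->
  F_transitive F T /\ forall x : X, dense (F_proximal_cell F T x).
Proof.
split=> [kT|[tT dP]].
  split; first exact: F_Kitai_transitive.
  by move=> x; exact: F_Kitai_proximal_dense.
exact: transitive_proximal_Kitai (infinite_dimensional_neq0 X_infdim) tT (dP 0).
Qed.
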